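(* Let $X$ be a $\mathcal K$-analytic space, $Y\supset X$ a space, and $\alpha\le\omega_1$. The following are equivalent: (1) $X\in\mathcal F_\alpha(Y)$; (2) $X=\mathbf R_\alpha(\mathcal C)$ for some Suslin scheme $\mathcal C$ in $Y$ consisting of closed subsets of $Y$; (3) $X=\mathbf R_\alpha(\mathcal C,Y)$ for some Suslin scheme $\mathcal C$ in $X$; (4) $X=\mathbf R_\alpha(\mathcal C,Y)$ for some Suslin scheme $\mathcal C$ which is complete on $X$.
   Context: All spaces Tychonoff. $\mathcal F$-Borel hierarchy: $\mathcal F_0(Y)$ closed sets; for $0<\alpha<\omega_1$, $\mathcal F_\alpha(Y)$ = countable unions (odd $\alpha$) or intersections (even $\alpha$) of members of $\bigcup_{\beta<\alpha}\mathcal F_\beta(Y)$ ($\lambda+m$ has the parity of $m$); $\mathcal F_{\omega_1}(Y)$ = Suslin-$\mathcal F$ subsets $\bigcup_{\sigma\in\omega^\omega}\bigcap_kF_{\sigma(0),\dots,\sigma(k)}$, $F$ closed. $\mathcal K$-analytic: Suslin-$\mathcal F$ in some compact space. Suslin scheme in $Y$: $\mathcal C=(C(s))_{s\in\omega^{<\omega}}$, $C(s)\subset Y$, $C(t)\subset C(s)$ if $t$ extends $s$; $\mathcal A(\mathcal C)=\bigcup_{\sigma\in\omega^\omega}\bigcap_nC(\sigma|n)$. $\mathcal C$ is complete on $X$ if it is a Suslin scheme in $X$ with $\mathcal A(\mathcal C)=X$ and every filter on $X$ containing, for each $n$, some set $C(s)$ with $|s|=n$, has an accumulation point in $X$. $\overline{\mathcal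 C}^Y=(\overline{C(s)\cap Y}^Y)_s$. Admissible maps $\varphi:T\to\omega^{<\omega}$: monotone w.r.t. extension with $|\varphi(t)|=t(0)+\dots+t(k)$. $\mathbf R_T(\mathcal D)=\{x\in D(\emptyset):\exists$ admissible $\varphi:T\to\omega^{<\omega}$ with $x\in D(\varphi(t))\ \forall t\in T\}$; $\mathbf R_T(\mathcal C,Y)=\mathbf R_T(\overline{\mathcal C}^Y)$. Trees $T_\beta$: fixed bijections $\pi_\beta:\omega\to\beta$ for countable limit $\beta$; $T_0=\{\emptyset\}$, $T_\beta=\{\emptyset\}\cup\bigcup_nn^\frown T_{\beta-1}$ (successor), $T_\beta=\{\emptyset\}\cup\bigcup_nn^\frown T_{\pi_\beta(n)}$ (limit), $T_{\omega_1}=\omega^{<\omega}$, where $n^\frown S=\{(n)^\frown s:s\in S\}$. For $\alpha=\lambda+2n+i$ ($\lambda$ limit or 0, $i\in\{0,1\}$) put $\alpha'=\lambda+n$; canonical trees: $T^c_\alpha=T_{\alpha'}$ for even $\alpha\le\omega_1$ (in particular $T^c_{\omega_1}=\omega^{<\omega}$), $T^c_\alpha=\{\emptyset\}\cup1^\frown T_{\alpha'}$ for odd $\alpha$. $\mathbf R_\alpha(\cdot)=\mathbf R_{T^c_\alpha}(\cdot)$ and $\mathbf R_\alpha(\mathcal C,Y)=\mathbf R_{T^c_\alpha}(\mathcal C,Y)$. *)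

(* Defs.v *)
From Stdlib Require Import Reals List.
Import ListNotations.
Set Implicit Arguments.
Open Scope R_scope.

Record Space := {
  pt :> Type;
  is_open : (pt -> Prop) -> Prop;
  open_ext : forall U V : pt -> Prop,
      (forall x, U x <-> V x) -> is_open U -> is_open V;
  open_full : is_open (fun _ => True);
  open_inter : forall U V, is_open U -> is_open V -> is_open (fun x => U x /\ V x);
  open_union : forall F : (pt -> Prop) -> Prop,
      (forall U, F U -> is_open U) -> is_open (fun x => exists U, F U /\ U x)
}.

Definition closed {Y : Space} (A : Y -> Prop) : Prop := is_open Y (fun x => ~ A x).

Definition closure {Y : Space} (A : Y -> Prop) : Y -> Prop :=
  fun x => forall U, is_open Y U -> U x -> exists z, U z /\ A z.

Definition continuous_real {Y : Space} (f : Y -> R) : Prop :=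
  forall a b : R, is_open Y (fun y => a < f y < b).

Definition Tychonoff (Y : Space) : Prop :=
  (forall x : Y, closed (fun y => y = x)) /\
  (forall (A : Y -> Prop) (x : Y), closed A -> ~ A x ->
     exists f : Y -> R, continuous_real f /\ f x = 0 /\
       (forall y, A y -> f y = 1) /\ (forall y, 0 <= f y <= 1)).

Definition compact (K : Space) : Prop :=
  forall F : (K -> Prop) -> Prop,
    (forall U, F U -> is_open K U) -> (forall x, exists U, F U /\ U x) ->
    exists l : list (K -> Prop), (forall U, In U l -> F U) /\
                                 (forall x, exists U, In U l /\ U x).

Definition pref (sigma : nat -> nat) (n : nat) : list nat := map sigma (seq 0 n).

Definition SuslinF {K : Space} (P : K -> Prop) : Prop :=
  exists F : list nat -> K -> Prop, (forall s, closed (F s)) /\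
    forall x, P x <-> exists sigma : nat -> nat, forall k, F (pref sigma (Datatypes.S k)) x.

(* X (a subspace of Y) is K-analytic: X is homeomorphic (via e) to a
   Suslin-F subset of some compact (Tychonoff) space K. *)
Definition Kanalytic {Y : Space} (X : Y -> Prop) : Prop :=
  exists (K : Space) (e : Y -> K),
    Tychonoff K /\ compact K /\
    (forall x y, X x -> X y -> e x = e y -> x = y) /\
    (forall V, is_open K V -> exists U, is_open Y U /\ forall x, X x -> (U x <-> V (e x))) /\
    (forall U, is_open Y U -> exists V, is_open K V /\ forall x, X x -> (U x <-> V (e x))) /\
    SuslinF (fun k => exists x, X x /\ e x = k).

(* ---------- Ordinals <= omega_1 ----------
   An abstract well-order with a top element w1 such that every element below
   w1 has countably many predecessors while w1 has uncountably many; any such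
   structure is isomorphic to omega_1 + 1. *)
Record OmegaOnePlusOne := {
  ord :> Type;
  olt : ord -> ord -> Prop;
  olt_wf : well_founded olt;
  olt_trans : forall a b c, olt a b -> olt b c -> olt a c;
  olt_total : forall a b, olt a b \/ a = b \/ olt b a;
  w1 : ord;
  ole_w1 : forall a, olt a w1 \/ a = w1;
  countable_below : forall a, olt a w1 ->
      exists f : nat -> ord, forall b, olt b a -> exists n, f n = b;
  uncountable_w1 : ~ exists f : nat -> ord, forall b, olt b w1 -> exists n, f n = b
}.

Section Ord.
Variable O : OmegaOnePlusOne.

Definition isZero (a : O) : Prop := forall b, ~ olt O b a.
Definition isSucc (a b : O) : Prop := olt O b a /\ forall c, olt O c a -> c = b \/ olt O c b.
Definition isLimit (a : O) : Prop := ~ isZero a /\ forall b, ~ isSucc a b.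

Inductive EvenO : O -> Prop :=
| ev_zero a : isZero a -> EvenO a
| ev_lim a : isLimit a -> EvenO a
| ev_succ a b : isSucc a b -> OddO b -> EvenO a
with OddO : O -> Prop :=
| od_succ a b : isSucc a b -> EvenO b -> OddO a.

(* HalfO a a' : a = lambda + 2n + i  ==>  a' = lambda + n *)
Inductive HalfO : O -> O -> Prop :=
| h_base a : isZero a \/ isLimit a -> HalfO a a
| h_ev a b h : isSucc a b -> EvenO b -> HalfO b h -> HalfO a h
| h_od a b h h' : isSucc a b -> OddO b -> HalfO b h -> isSucc h' h -> HalfO a h'.

Definition EnumLimits (pi : O -> nat -> O) : Prop :=
  forall b, isLimit b -> olt O b (w1 O) ->
    (forall n, olt O (pi b n) b) /\
    (forall n m, pi b n = pi b m -> n = m) /\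
    (forall c, olt O c b -> exists n, pi b n = c).

Inductive InT (pi : O -> nat -> O) : O -> list nat -> Prop :=
| t_nil b : InT pi b []
| t_succ b c n s : isSucc b c -> InT pi c s -> InT pi b (n :: s)
| t_lim b n s : isLimit b -> b <> w1 O -> InT pi (pi b n) s -> InT pi b (n :: s)
| t_w1 s : InT pi (w1 O) s.

Definition Tc (pi : O -> nat -> O) (a : O) (t : list nat) : Prop :=
  exists h, HalfO a h /\
    ((EvenO a /\ InT pi h t) \/
     (OddO a /\ (t = [] \/ exists s, t = 1%nat :: s /\ InT pi h s))).

Inductive FB (Y : Space) : O -> (Y -> Prop) -> Prop :=
| fb_zero a A : isZero a -> closed A -> FB Y a A
| fb_odd a A (An : nat -> Y -> Prop) (bn : nat -> O) :
    ~ isZero a -> olt O a (w1 O) -> OddO a ->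
    (forall n, olt O (bn n) a) -> (forall n, FB Y (bn n) (An n)) ->
    (forall y, A y <-> exists n, An n y) -> FB Y a A
| fb_even a A (An : nat -> Y -> Prop) (bn : nat -> O) :
    ~ isZero a -> olt O a (w1 O) -> EvenO a ->
    (forall n, olt O (bn n) a) -> (forall n, FB Y (bn n) (An n)) ->
    (forall y, A y <-> forall n, An n y) -> FB Y a A
| fb_w1 A : SuslinF A -> FB Y (w1 O) A.

End Ord.

Arguments isZero {O} a.
Arguments isSucc {O} a b.
Arguments isLimit {O} a.
Arguments EvenO {O} _.
Arguments OddO {O} _.
Arguments HalfO {O} _ _.
Arguments EnumLimits {O} pi.
Arguments InT {O} pi _ _.
Arguments Tc {O} pi a t.
Arguments FB {O} Y _ _.

Definition extends (t s : list nat) : Prop := exists u, t = s ++ u.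

Definition SuslinScheme {Y : Space} (C : list nat -> Y -> Prop) : Prop :=
  forall s t, extends t s -> forall y, C t y -> C s y.

Definition SchemeIn {Y : Space} (X : Y -> Prop) (C : list nat -> Y -> Prop) : Prop :=
  SuslinScheme C /\ forall s y, C s y -> X y.

Definition SuslinOp {Y : Space} (C : list nat -> Y -> Prop) : Y -> Prop :=
  fun y => exists sigma : nat -> nat, forall n, C (pref sigma n) y.

Definition FilterOn {Y : Space} (X : Y -> Prop) (Fl : (Y -> Prop) -> Prop) : Prop :=
  (forall A, Fl A -> forall y, A y -> X y) /\
  Fl X /\
  (forall A B, Fl A -> Fl B -> Fl (fun y => A y /\ B y)) /\
  (forall A B, Fl A -> (forall y, A y -> B y) -> (forall y, B y -> X y) -> Fl B) /\
  (forall A, Fl A -> exists y, A y).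

Definition CompleteOn {Y : Space} (X : Y -> Prop) (C : list nat -> Y -> Prop) : Prop :=
  SchemeIn X C /\ (forall y, SuslinOp C y <-> X y) /\
  forall Fl, FilterOn X Fl ->
    (forall n, exists s, length s = n /\ Fl (C s)) ->
    exists x, X x /\ forall A, Fl A -> closure A x.

Definition closureScheme {Y : Space} (C : list nat -> Y -> Prop) : list nat -> Y -> Prop :=
  fun s => closure (C s).

Definition Admissible (T : list nat -> Prop) (phi : list nat -> list nat) : Prop :=
  (forall s t, T s -> T t -> extends t s -> extends (phi t) (phi s)) /\
  (forall t, T t -> length (phi t) = list_sum t).

Definition RT {Y : Space} (T : list nat -> Prop) (D : list nat -> Y -> Prop) : Y -> Prop :=
  fun x => D [] x /\ exists phi, Admissible T phi /\ forall t, T t -> D (phi t) x.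

Definition Ralpha {O : OmegaOnePlusOne} (pi : O -> nat -> O) (a : O)
  {Y : Space} (D : list nat -> Y -> Prop) : Y -> Prop := RT (Tc pi a) D.

(* Main.v *)
(** For a closed scheme [D] and any tree [T] one has [A(D) c R_T(D)]. So if
    [R_T(D) c X c A(D)] and [E] is a complete scheme on [X], then the scheme
    [C(s) = D(s') n E(s'')], where [s] codes the pair [(s', s'')] entrywise, is
    complete on [X] and satisfies [X = A(C) c R_T(closure C) c R_T(D) c X]. Hence
    (1) => (4) reduces to finding, for [X] of class [alpha] and [T = T^c_alpha], a
    closed [D] with [R_T(D) c X c A(D)]; no compactness is involved in this, and it
    goes by induction on [alpha], interleaving the schemes of the sets whose union or
    intersection is [X]. At a limit [alpha], the [k]-th set is assigned to a child
    [n > k] of the root whose subtree belongs to a class containing that set; such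
    an [n] exists because infinitely many subtrees are large enough.

    Conversely, [R_T(C)] for a tree [T] with subtrees [S_n] is the intersection over
    [n] of the unions over [|s| = n] of [R_{S_n}(C(s^.))], which gives (2) => (1) by
    induction on [alpha]. *)
Require Import Defs.
From Stdlib Require Import Reals List.
From Stdlib Require Import Arith Lia Cantor Classical ClassicalEpsilon.
Import ListNotations.
Local Open Scope nat_scope.

(** * Choice, finite sequences, branches and their coding *)

Lemma choice_fun {A B : Type} (P : A -> B -> Prop) :
  (forall a, exists b, P a b) -> exists f, forall a, P a (f a).
Proof.
  intros H.
  exists (fun a => proj1_sig (constructive_indefinite_description _ (H a))).
  intros a. exact (proj2_sig (constructive_indefinite_description _ (H a))).
Qed.

Lemma extends_refl s : extends s s.
Proof. exists []. now rewrite app_nil_r. Qed.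

Lemma extends_nil s : extends s [].
Proof. now exists s. Qed.

Lemma extends_trans u t s : extends u t -> extends t s -> extends u s.
Proof. intros [a ->] [b ->]. exists (b ++ a). now rewrite app_assoc. Qed.

Lemma extends_firstn n s : extends s (firstn n s).
Proof. exists (skipn n s). now rewrite firstn_skipn. Qed.

Lemma extends_map (f : nat -> nat) t s : extends t s -> extends (map f t) (map f s).
Proof. intros [u ->]. exists (map f u). apply map_app. Qed.

Lemma extends_skipn k t s :
  k <= length s -> extends t s -> extends (skipn k t) (skipn k s).
Proof.
  intros Hk [u ->]. exists u. rewrite skipn_app.
  now replace (k - length s) with 0 by lia.
Qed.

Lemma extends_firstn_le p q t s :
  p <= q -> p <= length s -> extends t s -> extends (firstn q t) (firstn p s).
Proof.
  intros Hpq Hp [u ->].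
  replace (firstn p s) with (firstn p (firstn q (s ++ u))).
  - apply extends_firstn.
  - rewrite firstn_firstn, Nat.min_l, firstn_app by exact Hpq.
    replace (p - length s) with 0 by lia. apply app_nil_r.
Qed.

Lemma extends_cons_inv n t s : extends t (n :: s) -> exists t', t = n :: t' /\ extends t' s.
Proof. intros [u ->]. exists (s ++ u). split; [reflexivity | now exists u]. Qed.

Lemma list_sum_extends t s : extends t s -> list_sum s <= list_sum t.
Proof. intros [u ->]. rewrite list_sum_app. lia. Qed.

Lemma length_pref f n : length (pref f n) = n.
Proof. unfold pref. now rewrite length_map, length_seq. Qed.

Lemma pref_succ f n : pref f (S n) = pref f n ++ [f n].
Proof. unfold pref. now rewrite seq_S, map_app. Qed.

Lemma extends_pref f m n : m <= n -> extends (pref f n) (pref f m).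
Proof.
  induction 1 as [|n _ IH]; [apply extends_refl|].
  apply extends_trans with (2 := IH). exists [f n]. apply pref_succ.
Qed.

Lemma map_pref (g : nat -> nat) f n : map g (pref f n) = pref (fun i => g (f i)) n.
Proof. unfold pref. now rewrite map_map. Qed.

Lemma pref_ext f g n : (forall i, i < n -> f i = g i) -> pref f n = pref g n.
Proof.
  intros H. apply map_ext_in. intros i Hi. apply in_seq in Hi. apply H. lia.
Qed.

Lemma skipn_pref f k n : skipn k (pref f n) = pref (fun i => f (k + i)) (n - k).
Proof.
  revert f n; induction k as [|k IH]; intros f n.
  - simpl. now rewrite Nat.sub_0_r.
  - destruct n as [|n]; [reflexivity|].
    unfold pref at 1. simpl. rewrite <- seq_shift, map_map.
    exact (IH (fun i => f (S i)) n).
Qed.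

Lemma pref_nth s : pref (fun i => nth i s 0) (length s) = s.
Proof.
  induction s as [|a s IH]; [reflexivity|].
  unfold pref. simpl. rewrite <- seq_shift, map_map. f_equal. exact IH.
Qed.

Lemma branch_of_chain (s : nat -> list nat) :
  (forall n, length (s n) = n) -> (forall n, extends (s (S n)) (s n)) ->
  exists sigma, forall n, s n = pref sigma n.
Proof.
  (* The default 0 is never read, since [s (S n)] has length [S n]. *)
  intros Hl He. exists (fun n => nth n (s (S n)) 0).
  induction n as [|n IH].
  - specialize (Hl 0). now destruct (s 0).
  - rewrite pref_succ, <- IH. destruct (He n) as [u Hu].
    pose proof (Hl (S n)) as HlS. rewrite Hu, length_app, Hl in HlS.
    destruct u as [|a [|]]; simpl in HlS; try lia.
    rewrite Hu, app_nth2; rewrite Hl; [|lia]. now rewrite Nat.sub_diag.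
Qed.

(* Iterated Cantor unpairing: [j] codes the infinite sequence [dec j]. *)
Fixpoint dec (j k : nat) : nat :=
  match k with
  | 0 => fst (Cantor.of_nat j)
  | S k => dec (snd (Cantor.of_nat j)) k
  end.

(** One number can carry any finite list of prescribed entries. This serves to enumerate the
    sequences of a given length and to run several branches in parallel. *)
Lemma dec_surj n (f : nat -> nat) : exists j, forall k, k < n -> dec j k = f k.
Proof.
  revert f; induction n as [|n IH]; intros f.
  - exists 0. lia.
  - destruct (IH (fun k => f (S k))) as [j Hj].
    exists (Cantor.to_nat (f 0, j)). intros [|k] Hk; cbn [dec]; rewrite Cantor.cancel_of_to.
    + reflexivity.
    + apply Hj. simpl. lia.
Qed.

(** * Closed sets and closures *)

Section Topology.
Context {Y : Space}.
Implicit Types (A B : Y -> Prop) (C D : list nat -> Y -> Prop).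

Lemma closed_ext A B : (forall y, A y <-> B y) -> closed A -> closed B.
Proof. intros H. apply open_ext. intros y. now rewrite H. Qed.

Lemma closed_forall {I : Type} (F : I -> Y -> Prop) :
  (forall i, closed (F i)) -> closed (fun y => forall i, F i y).
Proof.
  intros H.
  refine (open_ext Y _ _ _ (open_union Y (fun U => exists i, U = fun y => ~ F i y) _));
    [intros y; split | intros U [i ->]; apply H].
  - intros [U [[i ->] Hy]] Hall. exact (Hy (Hall i)).
  - intros Hy. apply not_all_ex_not in Hy as [i Hi]. exists (fun z => ~ F i z). eauto.
Qed.

Lemma closed_impl (P : Prop) A : (P -> closed A) -> closed (fun y => P -> A y).
Proof.
  intros H. refine (closed_ext _ _ _ (closed_forall (fun _ : P => A) H)). tauto.
Qed.

Lemma closed_True : closed (fun _ : Y => True).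
Proof.
  refine (closed_ext _ _ _ (closed_impl False (fun _ => True) (fun h => False_ind _ h))). tauto.
Qed.

Lemma closure_closed A : closed (closure A).
Proof.
  refine (open_ext Y _ _ _ (open_union Y (fun U => is_open Y U /\ forall z, U z -> ~ A z) _));
    [intros y; split | now intros U [HU _]].
  - intros [U [[HU Hd] Hy]] Hc. destruct (Hc U HU Hy) as [z [Hz Az]]. exact (Hd z Hz Az).
  - intros Hy. apply not_all_ex_not in Hy as [U HU].
    exists U. apply imply_to_and in HU as [HU Hy]. apply imply_to_and in Hy as [Hy HA].
    repeat split; trivial. intros z Hz Az. apply HA. eauto.
Qed.

Lemma closure_incl A y : A y -> closure A y.
Proof. intros Hy U _ Uy. eauto. Qed.

Lemma closure_mono A B y : (forall z, A z -> B z) -> closure A y -> closure B y.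
Proof. intros H Hy U HU Uy. destruct (Hy U HU Uy) as [z [Hz Az]]. eauto. Qed.

Lemma closure_min A B y : closed B -> (forall z, A z -> B z) -> closure A y -> B y.
Proof.
  intros HB H Hy. apply NNPP. intros HBy.
  destruct (Hy _ HB HBy) as [z [Hz Az]]. auto.
Qed.

(** * Suslin schemes and the operator [RT] *)

Lemma scheme_firstn C n s y : SuslinScheme C -> C s y -> C (firstn n s) y.
Proof. intros HC. apply HC, extends_firstn. Qed.

(** An admissible map may take all its values on a single branch. *)
Lemma SuslinOp_RT (T : list nat -> Prop) C y : SuslinOp C y -> RT T C y.
Proof.
  intros [sigma H]. split; [exact (H 0)|].
  exists (fun t => pref sigma (list_sum t)). repeat split.
  - intros s t _ _ Hst. apply extends_pref, list_sum_extends, Hst.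
  - intros t _. apply length_pref.
  - intros t _. apply H.
Qed.

Lemma RT_anti (S T : list nat -> Prop) C y : (forall t, S t -> T t) -> RT T C y -> RT S C y.
Proof.
  intros H [H0 [phi [[Hm Hl] Hx]]]. split; [exact H0|]. exists phi.
  repeat split; auto.
Qed.

(** On sequences of ones the sum equals the length, so [phi] maps them to a chain with one member of
    each length, which is a branch. *)
Lemma RT_full C y : RT (fun _ => True) C y -> SuslinOp C y.
Proof.
  intros [_ [phi [[Hm Hl] Hx]]].
  destruct (branch_of_chain (fun n => phi (repeat 1 n))) as [sigma Hs].
  - intros n. rewrite Hl by trivial. induction n; simpl; auto.
  - intros n. apply Hm; trivial. exists [1]. apply repeat_cons.
  - exists sigma. intros n. rewrite <- Hs. auto.
Qed.

(* The tree whose root has the subtree [S n] above its child [n], where an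
   empty [S n] means that the child [n] is missing. *)
Definition join (S : nat -> list nat -> Prop) (t : list nat) : Prop :=
  match t with [] => True | n :: s => S n s end.

Definition shift (s : list nat) C (t : list nat) : Y -> Prop := C (s ++ t).

Lemma shift_scheme s C : SuslinScheme C -> SuslinScheme (shift s C).
Proof.
  intros HC t u [v ->] y. apply HC. exists v. now rewrite app_assoc.
Qed.

Lemma RT_join (S : nat -> list nat -> Prop) C y :
  (forall n s, S n s -> S n []) ->
  RT (join S) C y <->
  C [] y /\ forall n, S n [] -> exists s, length s = n /\ RT (S n) (shift s C) y.
Proof.
  intros HS. split.
  - intros [H0 [phi [[Hm Hl] Hx]]]. split; [exact H0|]. intros n Hn.
    (* Every [phi (n :: t)] extends [phi [n]], which has length [n]; removing these [n] entries
       leaves an admissible map on [S n]. *)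
    assert (Hphi : forall t, S n t -> phi [n] ++ skipn n (phi (n :: t)) = phi (n :: t)).
    { intros t Ht.
      destruct (Hm [n] (n :: t) Hn Ht ltac:(now exists t)) as [u ->].
      rewrite skipn_app, skipn_all2; rewrite Hl by exact Hn; simpl; [|lia].
      now replace (n - (n + 0)) with 0 by lia. }
    exists (phi [n]). split; [rewrite Hl by exact Hn; simpl; lia|].
    split; [unfold shift; rewrite app_nil_r; now apply Hx|].
    exists (fun t => skipn n (phi (n :: t))). repeat split.
    + intros s t Hs Ht [u ->]. apply extends_skipn.
      * rewrite Hl by exact Hs. simpl. lia.
      * apply Hm; trivial. now exists u.
    + intros t Ht. rewrite length_skipn, Hl by exact Ht. simpl. lia.
    + intros t Ht. unfold shift. rewrite Hphi by exact Ht. now apply Hx.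
  - intros [H0 H]. split; [exact H0|].
    destruct (choice_fun (fun n (p : list nat * (list nat -> list nat)) => S n [] ->
      length (fst p) = n /\ Admissible (S n) (snd p) /\
      forall t, S n t -> C (fst p ++ snd p t) y)) as [f Hf].
    (* A missing child gets an arbitrary pair, which is never evaluated on the tree because [S n s]
       implies [S n []]. *)
    { intros n. destruct (classic (S n [])) as [Hn|Hn].
      - destruct (H n Hn) as [s [Hs [_ [phi Hphi]]]]. now exists (s, phi).
      - now exists ([], fun t => t). }
    exists (fun t => match t with [] => [] | n :: s => fst (f n) ++ snd (f n) s end).
    repeat split.
    + intros [|n s] t Hs Ht Hst; [apply extends_nil|].
      apply extends_cons_inv in Hst as [t' [-> Hst]].
      destruct (Hf n (HS _ _ Hs)) as [_ [[Hm _] _]].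
      destruct (Hm s t' Hs Ht Hst) as [u ->]. exists u. apply app_assoc.
    + intros [|n s] Hs; [reflexivity|].
      destruct (Hf n (HS _ _ Hs)) as [Hn [[_ Hl] _]].
      rewrite length_app, Hn, Hl by exact Hs. reflexivity.
    + intros [|n s] Hs; [exact H0|]. now apply (Hf n (HS _ _ Hs)).
Qed.

Lemma RT_shift_base (T : list nat -> Prop) s C y :
  SuslinScheme C -> RT T (shift s C) y -> C [] y.
Proof.
  intros HC [H _]. exact (HC [] _ (extends_nil _) y H).
Qed.

Definition stem (S : list nat -> Prop) : list nat -> Prop := join (fun n t => n = 1 /\ S t).

(** The root has a single child, so nothing is intersected; that child is 1, so the union runs over
    sequences of length one, that is, over numbers. *)
Lemma RT_stem (S : list nat -> Prop) C y :
  SuslinScheme C -> S [] ->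
  RT (stem S) C y <-> exists m, RT S (shift [m] C) y.
Proof.
  intros HC HS. unfold stem. rewrite RT_join by (intros n s [-> _]; auto). split.
  - intros [_ H]. destruct (H 1 (conj eq_refl HS)) as [s [Hs Hy]].
    destruct s as [|m [|]]; try discriminate Hs. exists m. revert Hy. apply RT_anti. auto.
  - intros [m Hm]. split; [exact (RT_shift_base _ _ _ _ HC Hm)|].
    intros n [-> _]. exists [m]. split; [reflexivity|].
    revert Hm. apply RT_anti. now intros t [_ Ht].
Qed.

(** Reindexes the union over sequences of length [n] by natural numbers, the form that [FB] asks
    for. *)
Lemma RT_join_dec (S : nat -> list nat -> Prop) C y :
  SuslinScheme C -> (forall n, S n []) ->
  RT (join S) C y <-> forall n, exists j, RT (S n) (shift (pref (dec j) n) C) y.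
Proof.
  intros HC HS. rewrite RT_join by auto. split.
  - intros [_ H] n. destruct (H n (HS n)) as [s [<- Hy]].
    destruct (dec_surj (length s) (fun i => nth i s 0)) as [j Hj]. exists j.
    now rewrite (pref_ext _ _ _ Hj), pref_nth.
  - intros H. split.
    + destruct (H 0) as [j Hj]. exact (RT_shift_base _ _ _ _ HC Hj).
    + intros n _. destruct (H n) as [j Hj]. exists (pref (dec j) n).
      now rewrite length_pref.
Qed.

(** * Sets represented by closed schemes: unions, intersections, Suslin sets *)

(* Since [SuslinOp D] is contained in [RT T D], the set [A] equals both. *)
Definition represented (T : list nat -> Prop) A : Prop :=
  exists D, SuslinScheme D /\ (forall s, closed (D s)) /\
    (forall y, RT T D y -> A y) /\ (forall y, A y -> SuslinOp D y).

Lemma represented_mono (S T : list nat -> Prop) A :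
  (forall t, S t -> T t) -> represented S A -> represented T A.
Proof.
  intros H [D [HD [Hc [H1 H2]]]]. exists D. repeat split; auto.
  intros y Hy. apply H1. revert Hy. now apply RT_anti.
Qed.

Lemma represented_closed T A : closed A -> represented T A.
Proof.
  intros HA. exists (fun _ => A). split; [|split; [|split]].
  - intros s t _ y Hy. exact Hy.
  - intros _. exact HA.
  - intros y [Hy _]. exact Hy.
  - intros y Hy. now exists (fun _ => 0).
Qed.

(** The first entry of a sequence selects a set [An n], and the remaining entries index its
    scheme. *)
Lemma represented_union (S : list nat -> Prop) A (An : nat -> Y -> Prop) :
  S [] -> (forall n, represented S (An n)) -> (forall y, A y <-> exists n, An n y) ->
  represented (stem S) A.
Proof.
  intros HS Hn HA. destruct (choice_fun _ Hn) as [D HD].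
  set (E := fun s => match s with [] => fun _ => True | n :: s => D n s end).
  assert (HE : SuslinScheme E).
  { intros [|n s] t Hst y Hy; [exact I|].
    apply extends_cons_inv in Hst as [t' [-> Hst]].
    destruct (HD n) as [H _]. exact (H s t' Hst y Hy). }
  exists E. split; [exact HE|]. split; [|split].
  - intros [|n s]; [apply closed_True|]. apply (HD n).
  - intros y Hy. apply RT_stem in Hy as [m Hm]; trivial.
    apply HA. exists m. destruct (HD m) as [_ [_ [H _]]]. now apply H.
  - intros y Hy. apply HA in Hy as [m Hm].
    destruct (HD m) as [_ [_ [_ H]]]. destruct (H y Hm) as [sigma Hs].
    exists (fun i => match i with 0 => m | S i => sigma i end).
    intros [|n]; [exact I|].
    unfold pref. simpl. rewrite <- seq_shift, map_map. exact (Hs n).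
Qed.

(* The [i]-th entry of a branch codes, for all [k <= i] at once, entry [i - k]
   of a branch of the scheme of [An k]. The child [p k] of the root of [T] is
   mapped to a sequence of length [p k > k], which decides the first entry of the
   branch for [An k]. *)
Lemma represented_inter (T : list nat -> Prop) (S : nat -> list nat -> Prop) (p : nat -> nat)
  A (An : nat -> Y -> Prop) :
  (forall k, S k []) -> (forall k, k < p k) -> (forall k t, S k t -> T (p k :: t)) ->
  (forall k, represented (stem (S k)) (An k)) -> (forall y, A y <-> forall k, An k y) ->
  represented T A.
Proof.
  intros HS Hp HT Hn HA. destruct (choice_fun _ Hn) as [E HE].
  set (col := fun k s => map (fun j => dec j k) (skipn k s)).
  exists (fun s y => forall k, k < length s -> E k (col k s) y).
  split; [|split; [|split]].
  - intros s t Hst y Hy k Hk. destruct (HE k) as [HEk _].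
    apply (HEk _ (col k t)).
    + apply extends_map, extends_skipn; [lia | exact Hst].
    + apply Hy. destruct Hst as [u ->]. rewrite length_app. lia.
  - intros s. apply closed_forall. intros k. apply closed_impl. intros _. apply (HE k).
  - intros y [_ [phi [[Hm Hl] Hx]]]. apply HA. intros k.
    destruct (HE k) as [HEk [_ [HAk _]]]. apply HAk.
    assert (Hlen : forall t, S k t -> length (phi (p k :: t)) = p k + list_sum t).
    { intros t Ht. exact (Hl _ (HT k t Ht)). }
    assert (Hcol : forall t, S k t -> E k (col k (phi (p k :: t))) y).
    { intros t Ht. apply Hx; auto. rewrite Hlen by exact Ht. specialize (Hp k). lia. }
    split; [exact (HEk [] _ (extends_nil _) y (Hcol [] (HS k)))|].
    (* The column has length [p k + list_sum t - k], at least [1 + list_sum t] because [k < p k]; it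
       is cut to the length that admissibility prescribes at [1 :: t]. *)
    exists (fun t => match t with [] => [] | _ :: t =>
      firstn (1 + list_sum t) (col k (phi (p k :: t))) end).
    repeat split.
    + intros [|n s] t Hs Ht Hst; [apply extends_nil|].
      apply extends_cons_inv in Hst as [t' [-> Hst]].
      destruct Hs as [_ Hs], Ht as [_ Ht]. specialize (Hp k).
      apply extends_firstn_le.
      * apply list_sum_extends in Hst. lia.
      * unfold col. rewrite length_map, length_skipn, Hlen by exact Hs. lia.
      * apply extends_map, extends_skipn; [rewrite Hlen by exact Hs; lia|].
        apply Hm; auto. destruct Hst as [u ->]. now exists u.
    + intros [|n t] Ht; [reflexivity|]. destruct Ht as [-> Ht]. specialize (Hp k).
      unfold col. rewrite length_firstn, length_map, length_skipn, Hlen by exact Ht.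
      simpl list_sum. lia.
    + intros [|n t] Ht.
      * exact (HEk [] _ (extends_nil _) y (Hcol [] (HS k))).
      * apply scheme_firstn; [exact HEk | now apply Hcol, Ht].
  - intros y Hy.
    assert (Hb : forall k, exists tau, forall n, E k (pref tau n) y).
    { intros k. destruct (HE k) as [_ [_ [_ H]]]. apply H. now apply HA. }
    destruct (choice_fun _ Hb) as [tau Htau].
    (* Entry [i] codes [tau k (i - k)] for all [k <= i], so column [k] of [sigma] reads [tau k] from
       its start. *)
    destruct (choice_fun _ (fun i => dec_surj (1 + i) (fun k => tau k (i - k)))) as [sigma Hs].
    exists sigma. intros n k Hk. unfold col. rewrite skipn_pref, map_pref.
    rewrite (pref_ext _ (tau k)); [apply Htau|].
    intros i _. rewrite Hs by lia. f_equal. lia.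
Qed.

Lemma SuslinF_ext A B : (forall y, A y <-> B y) -> SuslinF A -> SuslinF B.
Proof. intros H [F [Hc HF]]. exists F. split; trivial. intros y. now rewrite <- H. Qed.

(** [SuslinF] tests only nonempty prefixes; monotonicity of the scheme supplies the empty one. *)
Lemma SuslinF_SuslinOp C : (forall s, closed (C s)) -> SuslinScheme C -> SuslinF (SuslinOp C).
Proof.
  intros Hc HC. exists C. split; [exact Hc|]. intros y. split.
  - intros [sigma H]. exists sigma. auto.
  - intros [sigma H]. exists sigma. intros n.
    apply (HC (pref sigma n) (pref sigma (S n))); auto. apply extends_pref. lia.
Qed.

(** Intersecting [F] over the nonempty initial segments of the index makes it monotone without
    changing the Suslin set; on the full tree [RT] gives back the Suslin operation. *)
Lemma represented_SuslinF A : SuslinF A -> represented (fun _ => True) A.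
Proof.
  intros [F [Hc HF]].
  exists (fun s y => forall k, k < length s -> F (firstn (S k) s) y).
  assert (Hpre : forall sigma n k, k < n -> firstn (S k) (pref sigma n) = pref sigma (S k)).
  { intros sigma n k Hk. destruct (extends_pref sigma (S k) n Hk) as [u ->].
    rewrite firstn_app, length_pref, firstn_all2 by (rewrite length_pref; lia).
    rewrite Nat.sub_diag. apply app_nil_r. }
  repeat split.
  - intros s t [u ->] y Hy k Hk. specialize (Hy k).
    rewrite length_app, firstn_app in Hy. replace (S k - length s) with 0 in Hy by lia.
    simpl firstn at 2 in Hy. rewrite app_nil_r in Hy. apply Hy. lia.
  - intros s. apply closed_forall. intros k. apply closed_impl. auto.
  - intros y Hy. apply RT_full in Hy as [sigma H]. apply HF. exists sigma. intros k.
    rewrite <- (Hpre sigma (S k) k) by lia. apply H. rewrite length_pref. lia.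
  - intros y Hy. apply HF in Hy as [sigma H]. exists sigma. intros n k Hk.
    rewrite length_pref in Hk. rewrite Hpre by exact Hk. apply H.
Qed.

End Topology.

(** * Complete schemes on K-analytic sets *)

(* A single branch [sg x] is chosen for each [x], so that the sets of one level
   are disjoint; hence the members of the scheme lying in a given filter are
   automatically arranged along one branch. *)
Lemma Kanalytic_complete {Y : Space} (X : Y -> Prop) :
  Kanalytic X -> exists E, CompleteOn X E.
Proof.
  intros [K [e [_ [HK [_ [_ [Hopen [F [Fc HF]]]]]]]]].
  destruct (choice_fun (fun x sigma => X x -> forall k, F (pref sigma (S k)) (e x)))
    as [sg Hsg].
  { intros x. destruct (classic (X x)) as [Hx|Hx].
    - destruct (proj1 (HF (e x))) as [s Hs]; eauto.
    - now exists (fun _ => 0). }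
  set (E := fun s x => X x /\ pref (sg x) (length s) = s).
  exists E. split; [split|split].
  - intros s t [u ->] y [Hy H]. split; trivial.
    rewrite length_app in H.
    destruct (extends_pref (sg y) (length s) (length s + length u)) as [v Hv]; [lia|].
    rewrite Hv in H. apply (f_equal (firstn (length s))) in H.
    rewrite !firstn_app, length_pref, Nat.sub_diag in H.
    simpl in H. rewrite !app_nil_r, firstn_all in H.
    rewrite firstn_all2 in H by (rewrite length_pref; lia). exact H.
  - now intros s y [Hy _].
  - intros y. split.
    + intros [sigma H]. apply (H 0).
    + intros Hy. exists (sg y). intros n. split; trivial. now rewrite length_pref.
  - intros Fl [Hsub [HX [Hint [Hup Hne]]]] Hlev.
    destruct (choice_fun _ Hlev) as [s Hs].
    destruct (branch_of_chain s) as [sigma Hsigma].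
    { intros n. apply Hs. }
    { intros n. destruct (Hne _ (Hint _ _ (proj2 (Hs n)) (proj2 (Hs (S n)))))
        as [y [[_ H1] [_ H2]]].
      rewrite (proj1 (Hs n)) in H1. rewrite (proj1 (Hs (S n))) in H2.
      rewrite <- H1, <- H2. apply extends_pref. lia. }
    (* The image of the filter clusters at some [z] in [K]. Otherwise finitely many open sets, each
       missing the image of a member of the filter, cover [K], and these members have empty
       intersection. *)
    assert (Hz : exists z, forall A, Fl A -> closure (fun k => exists x, A x /\ e x = k) z).
    { apply NNPP. intros Hno.
      destruct (HK (fun V => is_open K V /\ exists A, Fl A /\ forall x, A x -> ~ V (e x)))
        as [l [Hl Hcov]].
      - now intros U [HU _].
      - intros z. apply NNPP. intros Hz. apply Hno. exists z. intros A HA V HV Vz.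
        apply NNPP. intros Hd. apply Hz. exists V. repeat split; trivial.
        exists A. split; trivial. intros x Ax Vx. apply Hd. eauto.
      - assert (Hfin : exists A, Fl A /\ forall x V, A x -> In V l -> ~ V (e x)).
        { clear Hcov. induction l as [|V l IH]; [now exists X|].
          destruct IH as [A [HA HAl]]; [intros U HU; apply Hl; now right|].
          destruct (Hl V (or_introl eq_refl)) as [_ [B [HB HBV]]].
          exists (fun y => A y /\ B y). split; [now apply Hint|].
          intros x W [Ax Bx] [<-|HW]; auto. }
        destruct Hfin as [A [HA HAl]]. destruct (Hne A HA) as [x Ax].
        destruct (Hcov (e x)) as [V [HV Vx]]. exact (HAl x V Ax HV Vx). }
    destruct Hz as [z Hz].
    (* The image of [E (s (S k))] lies in the closed set [F (pref sigma (S k))], which therefore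
       contains [z]. *)
    assert (Hx : exists x, X x /\ e x = z).
    { apply HF. exists sigma. intros k.
      apply closure_min with (A := fun w => exists x, E (s (S k)) x /\ e x = w); auto.
      - intros w [x [[Xx Hx] <-]]. rewrite (proj1 (Hs (S k))) in Hx.
        rewrite <- Hsigma, <- Hx. auto.
      - apply Hz, Hs. }
    destruct Hx as [x [Xx <-]]. exists x. split; trivial.
    intros A HA U HU Ux. destruct (Hopen U HU) as [V [HV HUV]].
    destruct (Hz A HA V HV (proj1 (HUV x Xx) Ux)) as [w [Vw [a [Aa <-]]]].
    exists a. split; trivial. apply HUV; trivial. exact (Hsub A HA a Aa).
Qed.

Lemma complete_representation {Y : Space} (X : Y -> Prop) (T : list nat -> Prop) :
  Kanalytic X -> represented T X ->
  exists C, CompleteOn X C /\ forall y, X y <-> RT T (closureScheme C) y.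
Proof.
  intros HX [D [HD [Dc [HDX HXD]]]].
  destruct (Kanalytic_complete _ HX) as [E [[HE HEX] [HEA HEF]]].
  set (l := map (fun j => dec j 0)). set (r := map (fun j => dec j 1)).
  set (C := fun s y => D (l s) y /\ E (r s) y).
  assert (HXC : forall y, X y -> SuslinOp C y).
  { intros y Hy. destruct (HXD y Hy) as [a Ha]. destruct (proj2 (HEA y) Hy) as [b Hb].
    destruct (choice_fun _ (fun i => dec_surj 2 (fun k => match k with 0 => a i | _ => b i end)))
      as [sigma Hs].
    exists sigma. intros n. unfold C, l, r. rewrite !map_pref. split.
    - rewrite (pref_ext _ a); [apply Ha|]. intros i _. apply (Hs i 0). lia.
    - rewrite (pref_ext _ b); [apply Hb|]. intros i _. apply (Hs i 1). lia. }
  assert (HCX : forall s y, C s y -> X y) by (intros s y [_ Hy]; exact (HEX _ _ Hy)).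
  exists C. split; [split; [split|split]|]; trivial.
  - intros s t Hst y [H1 H2]. split.
    + exact (HD _ _ (extends_map _ _ _ Hst) y H1).
    + exact (HE _ _ (extends_map _ _ _ Hst) y H2).
  - intros y. split; [|apply HXC]. intros [sigma H]. exact (HCX _ _ (H 0)).
  (* Completeness passes from [E] to [C]: a filter containing [C s] contains the larger set
     [E (r s)] of the same level. *)
  - intros Fl HFl Hlev. apply HEF; trivial. intros n.
    destruct (Hlev n) as [s [Hs HFs]]. exists (r s). split.
    + unfold r. now rewrite length_map.
    + destruct HFl as [_ [_ [_ [Hup _]]]]. refine (Hup _ _ HFs _ (HEX _)).
      now intros y [_ Hy].
  - intros y. split.
    + intros Hy. apply SuslinOp_RT. destruct (HXC y Hy) as [sigma H].
      exists sigma. intros n. now apply closure_incl.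
    (* The closure of [C s] lies in the closed set [D (l s)], and [l] preserves length and
       extension, so [l] after [phi] is admissible. *)
    + intros [H0 [phi [[Hm Hl] Hx]]]. apply HDX. split.
      * refine (closure_min _ _ _ (Dc []) _ H0). now intros z [Hz _].
      * exists (fun t => l (phi t)). repeat split.
        -- intros s t Hs Ht Hst. apply extends_map. auto.
        -- intros t Ht. unfold l. rewrite length_map. auto.
        -- intros t Ht. refine (closure_min _ _ _ (Dc _) _ (Hx t Ht)). now intros z [Hz _].
Qed.

(** * Ordinals: successors, limits, parity and halves *)

Section Ordinals.
Context {O : OmegaOnePlusOne}.
Implicit Types (a b c h : O).
Notation "a << b" := (olt O a b) (at level 70).

Lemma olt_irrefl a : ~ a << a.
Proof.
  induction a as [a IH] using (well_founded_induction (olt_wf O)).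
  intros H. exact (IH a H H).
Qed.

Lemma least_ord (P : O -> Prop) :
  (exists a, P a) -> exists a, P a /\ forall b, b << a -> ~ P b.
Proof.
  intros [a Ha]. apply NNPP. intros Hno. revert Ha.
  induction a as [a IH] using (well_founded_induction (olt_wf O)).
  intros Ha. apply Hno. exists a. split; [exact Ha | exact IH].
Qed.

Lemma succ_exists a b : a << b -> exists c, isSucc c a.
Proof.
  intros Hab. destruct (least_ord (fun c => a << c)) as [c [Hac Hmin]]; [eauto|].
  exists c. split; [exact Hac|]. intros d Hd. destruct (olt_total O a d) as [H|[H|H]]; auto.
  now destruct (Hmin d Hd).
Qed.

Lemma succ_le a b c : isSucc c a -> a << b -> c = b \/ c << b.
Proof.
  intros [Hac Hc] Hab. destruct (olt_total O c b) as [|[|Hbc]]; auto.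
  destruct (Hc b Hbc) as [->|Hba].
  - now apply olt_irrefl in Hab.
  - now destruct (olt_irrefl a (olt_trans O _ _ _ Hab Hba)).
Qed.

Lemma isSucc_fun a b c : isSucc b a -> isSucc c a -> b = c.
Proof.
  intros Hb Hc. destruct (succ_le _ _ _ Hb (proj1 Hc)) as [|Hbc]; trivial.
  destruct (succ_le _ _ _ Hc (proj1 Hb)) as [|Hcb]; [now symmetry|].
  now destruct (olt_irrefl b (olt_trans O _ _ _ Hbc Hcb)).
Qed.

Lemma isSucc_inj a b c : isSucc c a -> isSucc c b -> a = b.
Proof.
  intros [Hac Ha] [Hbc Hb]. destruct (Ha b Hbc) as [|Hba]; [now symmetry|].
  destruct (Hb a Hac) as [|Hab]; trivial.
  now destruct (olt_irrefl a (olt_trans O _ _ _ Hab Hba)).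
Qed.

Lemma zero_succ_limit a : isZero a \/ (exists b, isSucc a b) \/ isLimit a.
Proof.
  destruct (classic (isZero a)); auto. destruct (classic (exists b, isSucc a b)); auto.
  right; right. split; trivial. intros b Hb. eauto.
Qed.

Lemma base_not_succ a b : isZero a \/ isLimit a -> ~ isSucc a b.
Proof. intros [Hz|[_ Hl]] Hs; [exact (Hz b (proj1 Hs)) | exact (Hl b Hs)]. Qed.

Lemma succ_lt_limit a b c : isLimit a -> b << a -> isSucc c b -> c << a.
Proof.
  intros [_ Ha] Hb Hc. destruct (succ_le _ _ _ Hc Hb) as [->|]; trivial.
  now destruct (Ha b).
Qed.

Lemma w1_not_zero : ~ isZero (w1 O).
Proof.
  intros Hz. apply (uncountable_w1 O). exists (fun _ => w1 O).
  intros b Hb. now destruct (Hz b).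
Qed.

(** If [w1] were the successor of [b], then [b] together with an enumeration of its predecessors
    would enumerate everything below [w1]. *)
Lemma w1_limit : isLimit (w1 O).
Proof.
  split; [exact w1_not_zero|]. intros b [Hb Hs]. apply (uncountable_w1 O).
  destruct (countable_below O b Hb) as [f Hf].
  exists (fun n => match n with 0 => b | S n => f n end).
  intros c Hc. destruct (Hs c Hc) as [->|Hcb]; [now exists 0|].
  destruct (Hf c Hcb) as [n Hn]. now exists (S n).
Qed.

Lemma even_base a : isZero a \/ isLimit a -> EvenO a.
Proof. intros [H|H]; [now apply ev_zero | now apply ev_lim]. Qed.

Lemma even_inv a : EvenO a -> (isZero a \/ isLimit a) \/ exists b, isSucc a b /\ OddO b.
Proof. intros H. destruct H; eauto. Qed.

Lemma odd_inv a : OddO a -> exists b, isSucc a b /\ EvenO b.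
Proof. intros H. destruct H; eauto. Qed.

Lemma even_or_odd a : EvenO a \/ OddO a.
Proof.
  induction a as [a IH] using (well_founded_induction (olt_wf O)).
  destruct (zero_succ_limit a) as [Hz|[[b Hb]|Hl]].
  - left. now apply ev_zero.
  - destruct (IH b (proj1 Hb)).
    + right. eapply od_succ; eauto.
    + left. eapply ev_succ; eauto.
  - left. now apply ev_lim.
Qed.

Lemma not_even_odd a : EvenO a -> OddO a -> False.
Proof.
  induction a as [a IH] using (well_founded_induction (olt_wf O)).
  intros He Ho. apply odd_inv in Ho as [b [Hb Heb]].
  apply even_inv in He as [He|[c [Hc Hoc]]].
  - exact (base_not_succ _ _ He Hb).
  - rewrite (isSucc_inj _ _ _ Hc Hb) in Hoc. exact (IH b (proj1 Hb) Heb Hoc).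
Qed.

Lemma half_inv a h : HalfO a h ->
  (isZero a \/ isLimit a) /\ h = a \/
  (exists b, isSucc a b /\ EvenO b /\ HalfO b h) \/
  (exists b g, isSucc a b /\ OddO b /\ HalfO b g /\ isSucc h g).
Proof. intros H. destruct H; [left | right; left | right; right]; eauto 10. Qed.

Lemma half_fun a h h' : HalfO a h -> HalfO a h' -> h = h'.
Proof.
  revert h h'. induction a as [a IH] using (well_founded_induction (olt_wf O)).
  intros h h' H1 H2.
  apply half_inv in H1 as [[H1 ->]|[[b [Hb [Pb H1]]]|[b [g [Hb [Pb [H1 Hg]]]]]]];
  apply half_inv in H2 as [[H2 ->]|[[c [Hc [Pc H2]]]|[c [k [Hc [Pc [H2 Hk]]]]]]]; trivial;
  try (now destruct (base_not_succ _ _ H1 Hc)); try (now destruct (base_not_succ _ _ H2 Hb));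
  rewrite (isSucc_inj _ _ _ Hc Hb) in *.
  - exact (IH b (proj1 Hb) _ _ H1 H2).
  - now destruct (not_even_odd b).
  - now destruct (not_even_odd b).
  - rewrite (IH b (proj1 Hb) _ _ H2 H1) in Hk. exact (isSucc_fun _ _ _ Hg Hk).
Qed.

(** Bounds the half, so that [succ_exists] can provide its successor in [half_exists]. *)
Lemma half_le a h : HalfO a h -> h = a \/ h << a.
Proof.
  induction 1 as [a Ha|a b h Hb Pb H IH|a b h h' Hb Pb H IH Hh']; auto.
  - right. destruct IH as [->|IH]; [apply Hb | exact (olt_trans O _ _ _ IH (proj1 Hb))].
  - apply (succ_le h); trivial.
    destruct IH as [->|IH]; [apply Hb | exact (olt_trans O _ _ _ IH (proj1 Hb))].
Qed.

Lemma half_exists a : exists h, HalfO a h.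
Proof.
  induction a as [a IH] using (well_founded_induction (olt_wf O)).
  destruct (zero_succ_limit a) as [Hz|[[b Hb]|Hl]].
  - exists a. apply h_base. auto.
  - destruct (IH b (proj1 Hb)) as [h Hh]. destruct (even_or_odd b) as [Pb|Pb].
    + exists h. eapply h_ev; eauto.
    + destruct (succ_exists h a) as [h' Hh'].
      { destruct (half_le _ _ Hh) as [->|H]; [apply Hb|].
        exact (olt_trans O _ _ _ H (proj1 Hb)). }
      exists h'. eapply h_od; eauto.
  - exists a. apply h_base. auto.
Qed.

(** Consequently every child of the root of [Tc pi a] carries the same subtree as the only child of
    the root of [Tc pi b]. *)
Lemma half_even_succ a b c h :
  isSucc a b -> isSucc b c -> EvenO c -> HalfO a h -> exists g, HalfO c g /\ isSucc h g.
Proof.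
  intros Hb Hc Pc Ha. destruct (half_exists c) as [g Hg]. exists g. split; trivial.
  assert (Pb : OddO b) by (eapply od_succ; eauto).
  apply half_inv in Ha as [[Ha _]|[[d [Hd [Pd _]]]|[d [k [Hd [_ [H Hk]]]]]]].
  - now destruct (base_not_succ _ _ Ha Hb).
  - rewrite (isSucc_inj _ _ _ Hd Hb) in Pd. now destruct (not_even_odd b).
  - rewrite (isSucc_inj _ _ _ Hd Hb) in H.
    now rewrite (half_fun b g k (h_ev Hc Pc Hg) H).
Qed.

Lemma half_odd a b h : isSucc a b -> EvenO b -> HalfO a h -> HalfO b h.
Proof.
  intros Hb Pb Ha. destruct (half_exists b) as [g Hg].
  now rewrite (half_fun a h g Ha (h_ev Hb Pb Hg)).
Qed.

(** Zero and limits are their own halves, whereas even successors have successor halves, so the two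
    kinds never collide; for two even successors the induction goes two steps down. *)
Lemma half_even_inj a b h : EvenO a -> EvenO b -> HalfO a h -> HalfO b h -> a = b.
Proof.
  revert b h. induction a as [a IH] using (well_founded_induction (olt_wf O)).
  intros b h Ha Hb Hah Hbh.
  assert (Hbase : forall c d, isZero c \/ isLimit c -> HalfO c h -> EvenO d -> HalfO d h -> c = d).
  { intros c d Hc Hch Hd Hdh. rewrite (half_fun _ _ _ Hch (h_base Hc)) in *.
    apply even_inv in Hd as [Hd|[e [He Pe]]].
    - exact (half_fun _ _ _ Hdh (h_base Hd)).
    - apply odd_inv in Pe as [f [Hf Pf]].
      destruct (half_even_succ _ _ _ _ He Hf Pf Hdh) as [g [_ Hg]].
      now destruct (base_not_succ _ _ Hc Hg). }
  pose proof Ha as Pa. pose proof Hb as Pb.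
  apply even_inv in Ha as [Ha|[a1 [Ha1 Pa1]]]; [now apply Hbase|].
  apply even_inv in Hb as [Hb|[b1 [Hb1 Pb1]]]; [now symmetry; apply Hbase|].
  apply odd_inv in Pa1 as [a2 [Ha2 Pa2]]. apply odd_inv in Pb1 as [b2 [Hb2 Pb2]].
  destruct (half_even_succ _ _ _ _ Ha1 Ha2 Pa2 Hah) as [g [Hg Sg]].
  destruct (half_even_succ _ _ _ _ Hb1 Hb2 Pb2 Hbh) as [k [Hk Sk]].
  rewrite (isSucc_inj _ _ _ Sk Sg) in Hk.
  assert (a2 = b2) as <-.
  { apply (IH a2 (olt_trans O _ _ _ (proj1 Ha2) (proj1 Ha1)) b2 g); trivial. }
  rewrite (isSucc_fun _ _ _ Hb2 Ha2) in Hb1. exact (isSucc_fun _ _ _ Ha1 Hb1).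
Qed.

Lemma half_odd_inj a b h : OddO a -> OddO b -> HalfO a h -> HalfO b h -> a = b.
Proof.
  intros Pa Pb Ha Hb. apply odd_inv in Pa as [c [Hc Pc]]. apply odd_inv in Pb as [d [Hd Pd]].
  assert (c = d) as <-.
  { exact (half_even_inj c d h Pc Pd (half_odd _ _ _ Hc Pc Ha) (half_odd _ _ _ Hd Pd Hb)). }
  exact (isSucc_fun _ _ _ Hc Hd).
Qed.

(** A successor step in [h] costs two steps in [c], which stay below the limit. Thus the subtrees at
    the root of a limit tree are canonical trees of smaller even classes. *)
Lemma double_below_limit l h : isLimit l -> h << l -> exists c, EvenO c /\ HalfO c h /\ c << l.
Proof.
  intros Hl. induction h as [h IH] using (well_founded_induction (olt_wf O)). intros Hh.
  assert (Hbase : isZero h \/ isLimit h -> exists c, EvenO c /\ HalfO c h /\ c << l).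
  { intros H. exists h. repeat split; [now apply even_base | now apply h_base | exact Hh]. }
  destruct (zero_succ_limit h) as [Hz|[[g Hg]|Hl']]; auto.
  destruct (IH g (proj1 Hg) (olt_trans O _ _ _ (proj1 Hg) Hh)) as [c [Pc [Hc Hcl]]].
  destruct (succ_exists _ _ Hcl) as [d Hd].
  pose proof (succ_lt_limit _ _ _ Hl Hcl Hd) as Hdl.
  destruct (succ_exists _ _ Hdl) as [e He].
  assert (Pd : OddO d) by (eapply od_succ; eauto).
  exists e. repeat split.
  - eapply ev_succ; eauto.
  - exact (h_od He Pd (h_ev Hd Pc Hc) Hg).
  - exact (succ_lt_limit _ _ _ Hl Hdl He).
Qed.

Lemma odd_between b l : isLimit l -> b << l -> exists c, OddO c /\ c << l /\ (c = b \/ b << c).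
Proof.
  intros Hl Hb. destruct (even_or_odd b) as [Pb|Pb]; [|now exists b; auto].
  destruct (succ_exists _ _ Hb) as [c Hc]. exists c. repeat split.
  - eapply od_succ; eauto.
  - exact (succ_lt_limit _ _ _ Hl Hb Hc).
  - right. apply Hc.
Qed.

(** * Enumerations of limits and the canonical trees *)

Context (pi : O -> nat -> O) (Hpi : EnumLimits pi).

(** Finds a child of the root beyond any bound whose subtree suits an odd class not below [b]. If
    the index found is exactly [N], a larger odd ordinal is tried; its index cannot be [N] again,
    since halving is injective on odd ordinals. *)
Lemma odd_between_index l b N : isLimit l -> l << w1 O -> b << l ->
  exists c n, OddO c /\ c << l /\ (c = b \/ b << c) /\ HalfO c (pi l n) /\ N <= n.
Proof.
  intros Hl Hlw. destruct (Hpi l Hl Hlw) as [_ [Hinj Hsurj]].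
  revert b. induction N as [|N IH]; intros b Hb.
  - destruct (odd_between b l Hl Hb) as [c [Pc [Hc Hbc]]].
    destruct (half_exists c) as [h Hh]. destruct (Hsurj h) as [n <-].
    { destruct (half_le _ _ Hh) as [->|H]; trivial. exact (olt_trans O _ _ _ H Hc). }
    exists c, n. repeat split; trivial. lia.
  - destruct (IH b Hb) as [c [n [Pc [Hc [Hbc [Hn HNn]]]]]].
    destruct (Nat.eq_dec n N) as [->|HnN].
    2:{ exists c, n. repeat split; trivial. lia. }
    destruct (succ_exists _ _ Hc) as [d Hd].
    pose proof (succ_lt_limit _ _ _ Hl Hc Hd) as Hdl.
    destruct (IH d Hdl) as [c' [n' [Pc' [Hc' [Hdc' [Hn' HNn']]]]]].
    assert (Hcc' : c << c').
    { destruct Hdc' as [->|H]; [apply Hd | exact (olt_trans O _ _ _ (proj1 Hd) H)]. }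
    exists c', n'. repeat split; trivial.
    + right. destruct Hbc as [->|Hbc]; [exact Hcc' | exact (olt_trans O _ _ _ Hbc Hcc')].
    + destruct (Nat.eq_dec n' N) as [->|]; [|lia].
      rewrite (half_odd_inj _ _ _ Pc Pc' Hn Hn') in Hcc'. now apply olt_irrefl in Hcc'.
Qed.

Lemma InT_zero a t : isZero a -> InT pi a t -> t = [].
Proof.
  intros Hz H. destruct H as [|b c n s Hb _|b n s Hl _ _|]; trivial.
  - now destruct (Hz c (proj1 Hb)).
  - now destruct Hl.
  - now destruct (w1_not_zero Hz).
Qed.

Lemma InT_succ a b t : isSucc a b -> InT pi a t <-> join (fun _ => InT pi b) t.
Proof.
  intros Hb. split.
  - intros H. destruct H as [|a c n s Hc H|a n s Hl _ _|s]; simpl; trivial.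
    + now rewrite (isSucc_inj _ _ _ Hb Hc).
    + now destruct (base_not_succ a b (or_intror Hl)).
    + now destruct (base_not_succ _ b (or_intror w1_limit)).
  - destruct t as [|n s]; simpl; intros H; [apply t_nil | now apply t_succ with b].
Qed.

Lemma InT_limit a t :
  isLimit a -> a << w1 O -> InT pi a t <-> join (fun n => InT pi (pi a n)) t.
Proof.
  intros Ha Haw.
  assert (Hne : a <> w1 O) by (intros ->; exact (olt_irrefl _ Haw)). split.
  - intros H. destruct H as [|a c n s Hc H|a n s Hl _ H|s]; simpl; trivial.
    + now destruct (base_not_succ a c (or_intror Ha)).
    + now destruct Hne.
  - destruct t as [|n s]; simpl; intros H; [apply t_nil | now apply t_lim].
Qed.

Lemma Tc_even a h t : EvenO a -> HalfO a h -> Tc pi a t <-> InT pi h t.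
Proof.
  intros Pa Ha. split.
  - intros [g [Hg [[_ Ht]|[Po _]]]].
    + now rewrite (half_fun _ _ _ Ha Hg).
    + now destruct (not_even_odd a).
  - intros Ht. exists h. auto.
Qed.

Lemma Tc_odd a h t : OddO a -> HalfO a h -> Tc pi a t <-> stem (InT pi h) t.
Proof.
  intros Pa Ha. split.
  - intros [g [Hg [[Pe _]|[_ [->|[s [-> Ht]]]]]]].
    + now destruct (not_even_odd a).
    + exact I.
    + split; trivial. now rewrite (half_fun _ _ _ Ha Hg).
  - intros Ht. exists h. split; trivial. right. split; trivial.
    destruct t as [|n s]; auto. right. destruct Ht as [-> Ht]. eauto.
Qed.

Lemma Tc_w1 t : Tc pi (w1 O) t.
Proof.
  apply Tc_even with (w1 O).
  - apply ev_lim, w1_limit.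
  - apply h_base. right. apply w1_limit.
  - apply t_w1.
Qed.

(** * Borel classes against canonical trees *)

Context {Y : Space}.
Implicit Types (A B : Y -> Prop) (C : list nat -> Y -> Prop).

Lemma FB_ext a A B : (forall y, A y <-> B y) -> FB Y a A -> FB Y a B.
Proof.
  intros H HA. destruct HA as [a A Hz Hc|a A An bn Hz Hw P Hb Hn HA|a A An bn Hz Hw P Hb Hn HA|A HA].
  - apply fb_zero; trivial. exact (closed_ext _ _ H Hc).
  - apply fb_odd with An bn; trivial. intros y. now rewrite <- H.
  - apply fb_even with An bn; trivial. intros y. now rewrite <- H.
  - apply fb_w1. exact (SuslinF_ext _ _ H HA).
Qed.

(** A set is both the union and the intersection of the constant sequence with its value. *)
Lemma FB_mono a b A : b = a \/ b << a -> a << w1 O -> FB Y b A -> FB Y a A.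
Proof.
  intros [->|Hba] Ha HA; trivial.
  assert (Hz : ~ isZero a) by (intros Hz; exact (Hz b Hba)).
  destruct (even_or_odd a).
  - apply fb_even with (fun _ => A) (fun _ => b); trivial. intros y. split; auto.
    intros Hy. exact (Hy 0).
  - apply fb_odd with (fun _ => A) (fun _ => b); trivial. intros y. split; [now exists 0|].
    now intros [_ Hy].
Qed.

Lemma FB_zero_inv a A : isZero a -> FB Y a A -> closed A.
Proof.
  intros Hz HA. destruct HA; trivial; try contradiction. now destruct (w1_not_zero Hz).
Qed.

Lemma FB_odd_inv a b A : isSucc a b -> EvenO b -> FB Y a A ->
  exists An : nat -> Y -> Prop, (forall n, FB Y b (An n)) /\ forall y, A y <-> exists n, An n y.
Proof.
  intros Hb Pb HA. assert (Pa : OddO a) by (eapply od_succ; eauto).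
  destruct HA as [a A Hz Hc|a A An bn Hz Hw P Hbn Hn HA|a A An bn Hz Hw P Hbn Hn HA|A HA].
  - now destruct (base_not_succ a b (or_introl Hz)).
  - exists An. split; trivial. intros n. apply FB_mono with (bn n); auto.
    + now apply Hb.
    + exact (olt_trans O _ _ _ (proj1 Hb) Hw).
  - now destruct (not_even_odd a).
  - now destruct (base_not_succ (w1 O) b (or_intror w1_limit)).
Qed.

Lemma FB_even_inv a A : ~ isZero a -> a << w1 O -> EvenO a -> FB Y a A ->
  exists (An : nat -> Y -> Prop) (bn : nat -> O), (forall n, bn n << a) /\ (forall n, FB Y (bn n) (An n)) /\
    forall y, A y <-> forall n, An n y.
Proof.
  intros Hz Hw Pa HA.
  destruct HA as [a A Hz' Hc|a A An bn _ _ P Hbn Hn HA|a A An bn _ _ P Hbn Hn HA|A HA].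
  - contradiction.
  - now destruct (not_even_odd a).
  - eauto.
  - now apply olt_irrefl in Hw.
Qed.

Lemma FB_represented a A : FB Y a A -> represented (Tc pi a) A.
Proof.
  destruct (ole_w1 O a) as [Haw| ->].
  2:{ intros HA. assert (HS : SuslinF A).
      { remember (w1 O) as w eqn:Hw in HA. destruct HA as [a A Hz|a A ? ? _ H|a A ? ? _ H|]; trivial.
        - subst a. now destruct (w1_not_zero Hz).
        - subst a. now apply olt_irrefl in H.
        - subst a. now apply olt_irrefl in H. }
      apply represented_mono with (2 := represented_SuslinF A HS).
      intros t _. apply Tc_w1. }
  revert A Haw. induction a as [a IH] using (well_founded_induction (olt_wf O)).
  intros A Haw HA. destruct (half_exists a) as [h Hh]. destruct (even_or_odd a) as [Pa|Pa].
  - destruct (classic (isZero a)) as [Hz|Hz].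
    { apply represented_closed. exact (FB_zero_inv a A Hz HA). }
    destruct (FB_even_inv a A Hz Haw Pa HA) as [An [bn [Hbn [Hn HAn]]]].
    apply represented_mono with (InT pi h); [intros t Ht; now apply (Tc_even a h)|].
    destruct (even_inv a Pa) as [[Hz'|Hl]|[b [Hb Pb]]]; [contradiction| |].
    (* Each [An k] is raised to an odd class [c k] with half [pi a (p k)] and [k < p k], so
       [Tc pi (c k)] is the stem of the subtree at the child [p k]. *)
    + rewrite (half_fun _ _ _ Hh (h_base (or_intror Hl))) in *. clear Hh h.
      destruct (choice_fun _ (fun k => odd_between_index a (bn k) (S k) Hl Haw (Hbn k)))
        as [c Hc].
      destruct (choice_fun _ Hc) as [p Hp].
      apply represented_inter with (fun k => InT pi (pi a (p k))) p An; trivial.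
      * intros k. apply t_nil.
      * intros k. apply Hp.
      * intros k t Ht. now apply InT_limit.
      * intros k. destruct (Hp k) as [Pc [Hca [Hbc [Hhc _]]]].
        pose proof (olt_trans O _ _ _ Hca Haw) as Hcw.
        apply represented_mono with (Tc pi (c k)).
        -- intros t Ht. now apply (Tc_odd (c k)).
        -- apply IH; trivial. apply FB_mono with (bn k); trivial.
           destruct Hbc as [->|]; auto.
    (* All children of the root carry the tree of [g], whose stem is [Tc pi b]; hence any child
       beyond [k] serves, and [S k] is taken. *)
    + destruct (odd_inv b Pb) as [c [Hc Pc]].
      destruct (half_even_succ _ _ _ _ Hb Hc Pc Hh) as [g [Hg Sg]].
      pose proof (olt_trans O _ _ _ (proj1 Hb) Haw) as Hbw.
      apply represented_inter with (fun _ => InT pi g) S An; trivial.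
      * intros k. apply t_nil.
      * intros k. lia.
      * intros k t Ht. now apply (InT_succ h g).
      * intros k. apply represented_mono with (Tc pi b).
        -- intros t Ht. apply (Tc_odd b); trivial. exact (h_ev Hc Pc Hg).
        -- apply IH; [apply Hb | exact Hbw|]. apply FB_mono with (bn k); auto.
           apply Hb, Hbn.
  (* Here [a] and [b] have the same half, so [Tc pi a] is the stem of [Tc pi b]. *)
  - destruct (odd_inv a Pa) as [b [Hb Pb]].
    pose proof (half_odd _ _ _ Hb Pb Hh) as Hbh.
    destruct (FB_odd_inv a b A Hb Pb HA) as [An [Hn HAn]].
    apply represented_mono with (stem (InT pi h)); [intros t Ht; now apply (Tc_odd a h)|].
    apply represented_union with An; trivial; [apply t_nil|].
    intros n. apply represented_mono with (Tc pi b).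
    + intros t Ht. now apply (Tc_even b h).
    + apply IH; auto; [apply Hb | exact (olt_trans O _ _ _ (proj1 Hb) Haw)].
Qed.

Lemma RT_iff (S T : list nat -> Prop) C y :
  (forall t, S t <-> T t) -> RT S C y <-> RT T C y.
Proof. intros H. split; apply RT_anti; intros t; apply H. Qed.

Lemma FB_Ralpha a C :
  (forall s, closed (C s)) -> SuslinScheme C -> FB Y a (Ralpha pi a C).
Proof.
  unfold Ralpha. destruct (ole_w1 O a) as [Haw| ->].
  2:{ intros Hc HC. apply fb_w1.
      apply SuslinF_ext with (2 := SuslinF_SuslinOp C Hc HC). intros y. split.
      - apply SuslinOp_RT.
      - intros Hy. apply RT_full. revert Hy. apply RT_anti. intros t _. apply Tc_w1. }
  revert C Haw. induction a as [a IH] using (well_founded_induction (olt_wf O)).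
  intros C Haw Hc HC. destruct (half_exists a) as [h Hh].
  (* Passing to [shift s C] costs a countable union over [s], so one level. *)
  assert (Hodd : forall b c g (s : nat -> list nat), isSucc b c -> EvenO c -> HalfO c g ->
    c << a -> b << w1 O -> FB Y b (fun y => exists j, RT (InT pi g) (shift (s j) C) y)).
  { intros b c g s Hbc Pc Hg Hca Hbw.
    apply fb_odd with (fun j => RT (InT pi g) (shift (s j) C)) (fun _ => c); trivial.
    - intros Hz. exact (Hz c (proj1 Hbc)).
    - eapply od_succ; eauto.
    - intros _. apply Hbc.
    - intros j. refine (FB_ext _ _ _ _ (IH c Hca (shift (s j) C) _ _ _)).
      + intros y. apply RT_iff. intros t. now apply Tc_even.
      + exact (olt_trans O _ _ _ (proj1 Hbc) Hbw).
      + intros t. apply Hc.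
      + now apply shift_scheme.
    - tauto. }
  destruct (even_or_odd a) as [Pa|Pa].
  - destruct (even_inv a Pa) as [[Hz|Hl]|[b [Hb Pb]]].
    + apply fb_zero; trivial. apply closed_ext with (2 := Hc []). intros y. split.
      (* The tree consists of the root alone, so the identity is admissible on it. *)
      * intros Hy. split; trivial. exists (fun t => t).
        assert (Ht : forall t, Tc pi a t -> t = []).
        { intros t Ht. apply (Tc_even a a) in Ht; trivial; [now apply InT_zero in Ht|].
          apply h_base. auto. }
        repeat split; auto; intros t Htc; now rewrite (Ht t Htc).
      * now intros [Hy _].
    (* The subtree at [n] is the canonical tree of an even class [c n]; the union over sequences of
       length [n] has the next class [b n], still below the limit [a]. *)
    + assert (Hc' : forall n, exists c, EvenO c /\ HalfO c (pi a n) /\ c << a).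
      { intros n. apply double_below_limit; trivial. now apply (Hpi a Hl Haw). }
      destruct (choice_fun _ Hc') as [c Hcn].
      destruct (choice_fun (fun n b => isSucc b (c n))) as [b Hbn].
      { intros n. apply succ_exists with a. apply Hcn. }
      assert (Hba : forall n, b n << a).
      { intros n. apply succ_lt_limit with (c n); auto. apply Hcn. }
      refine (fb_even (Y := Y) _ (fun n y => exists j,
        RT (InT pi (pi a n)) (shift (pref (dec j) n) C) y) b _ Haw Pa Hba _ _).
      * intros Hz. now destruct Hl.
      * intros n. destruct (Hcn n) as [Pc [Hhc Hca]].
        apply (Hodd (b n) (c n)); trivial. exact (olt_trans O _ _ _ (Hba n) Haw).
      * intros y. rewrite <- RT_join_dec by (trivial; intros n; apply t_nil).
        apply RT_iff. intros t. rewrite Tc_even with (h := a); trivial.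
        -- now apply InT_limit.
        -- apply h_base. auto.
    (* All subtrees are the canonical tree of [c], so each union has class [b] and their
       intersection has class [a]. *)
    + destruct (odd_inv b Pb) as [c [Hbc Pc]].
      destruct (half_even_succ _ _ _ _ Hb Hbc Pc Hh) as [g [Hg Sg]].
      refine (fb_even (Y := Y) _ (fun n y => exists j,
        RT (InT pi g) (shift (pref (dec j) n) C) y) (fun _ => b) _ Haw Pa
        (fun _ => proj1 Hb) _ _).
      * intros Hz. exact (Hz b (proj1 Hb)).
      * intros n. apply (Hodd b c); trivial.
        -- exact (olt_trans O _ _ _ (proj1 Hbc) (proj1 Hb)).
        -- exact (olt_trans O _ _ _ (proj1 Hb) Haw).
      * intros y. rewrite <- (RT_join_dec (fun _ => InT pi g)) by (trivial; intros n; apply t_nil).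
        apply RT_iff. intros t. rewrite Tc_even with (h := h); trivial.
        now apply InT_succ.
  (* Only the child 1 is present, which leaves one union over the sequences [[j]], of class [a]
     itself. *)
  - destruct (odd_inv a Pa) as [b [Hb Pb]].
    refine (FB_ext _ _ _ _ (Hodd a b h (fun j => [j]) Hb Pb (half_odd _ _ _ Hb Pb Hh)
      (proj1 Hb) Haw)).
    intros y. rewrite <- RT_stem by (trivial; apply t_nil).
    apply RT_iff. intros t. symmetry. now apply Tc_odd.
Qed.

End Ordinals.

(** * Equivalence of the four conditions *)

Theorem theorem6p11 (O : OmegaOnePlusOne) (pi : O -> nat -> O)
  (Hpi : EnumLimits pi) (Y : Space) (HY : Tychonoff Y)
  (X : Y -> Prop) (HX : Kanalytic X) (alpha : O) :
  (FB Y alpha X <->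
     exists C : list nat -> Y -> Prop, SuslinScheme C /\ (forall s, closed (C s)) /\
       (forall y, X y <-> Ralpha pi alpha C y)) /\
  (FB Y alpha X <->
     exists C : list nat -> Y -> Prop, SchemeIn X C /\
       (forall y, X y <-> Ralpha pi alpha (closureScheme C) y)) /\
  (FB Y alpha X <->
     exists C : list nat -> Y -> Prop, CompleteOn X C /\
       (forall y, X y <-> Ralpha pi alpha (closureScheme C) y)).
Proof.
  assert (H14 : FB Y alpha X -> exists C : list nat -> Y -> Prop, CompleteOn X C /\
      (forall y, X y <-> Ralpha pi alpha (closureScheme C) y)).
  { intros HA. apply complete_representation; trivial. now apply FB_represented. }
  assert (H21 : forall C : list nat -> Y -> Prop, SuslinScheme C -> (forall s, closed (C s)) ->
      (forall y, X y <-> Ralpha pi alpha C y) -> FB Y alpha X).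
  { intros C HC Hc HXC. refine (FB_ext _ _ _ _ (FB_Ralpha pi Hpi alpha C Hc HC)).
    intros y. now rewrite HXC. }
  (* Conditions (3) and (4) fall under (2), because the closures of a Suslin scheme form a closed
     Suslin scheme. *)
  assert (Hcl : forall C : list nat -> Y -> Prop, SuslinScheme C ->
      SuslinScheme (closureScheme C) /\ forall s, closed (closureScheme C s)).
  { intros C HC. split.
    - intros s t Hst y. apply closure_mono. exact (HC s t Hst).
    - intros s. apply closure_closed. }
  repeat split.
  - intros HA. destruct (H14 HA) as [C [[[HC _] _] HXC]].
    exists (closureScheme C). destruct (Hcl C HC). auto.
  - intros [C [HC [Hc HXC]]]. exact (H21 C HC Hc HXC).
  - intros HA. destruct (H14 HA) as [C [[HC _] HXC]]. eauto.
  - intros [C [[HC _] HXC]]. destruct (Hcl C HC). eauto.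
  - exact H14.
  - intros [C [[[HC _] _] HXC]]. destruct (Hcl C HC). eauto.
Qed.
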